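(* Let $(X,d_X)$ and $(Y,d_Y)$ be metric spaces, and let a function $\varphi\in C^1(0,\infty)$ be non-negative on $[0,\infty)$ with the following property: there exists a constant $A>0$ such that $$\frac{\varphi(t)}{t}<A\,\varphi'(t),\quad t\in(0,\infty).$$ Then for every $K>0$ and every weight $w$ on the metric space $X$, every $f\in\Lambda_\varphi(X,Y)\cap\mathrm{RO}^K_w(X,Y)$ belongs to $\mathrm{B}_{\varphi'\circ w}(X,Y)$ and $$\|f\|_{\mathrm{B}_{\varphi'\circ w}(X,Y)}\le A K\,\|f\|_{\Lambda_\varphi(X,Y)}.$$
   Context: A weight on a metric space is an everywhere positive and continuous real function on it. $B_X(x,r)$ denotes the open ball in $X$. For $f:X\to Y$ between metric spaces put $D^\ast f(x)=\limsup_{y\to x}\frac{d_Y(f(x),f(y))}{d_X(x,y)}$ for $x\in X$, with $D^\ast f(x)=0$ if $x$ is isolated. $D^\ast(X,Y)$ is the class of $f:X\to Y$ with $D^\ast f(x)<\infty$ for every $x\in X$. For a weight $w$ on $X$ and a constant $K$, $\mathrm{RO}^K_w(X,Y)$ (regularly oscillating mappings with constant $K$) is the class of $f\in D^\ast(X,Y)$ that are bounded on every open ball $B_X(x,r)$, $x\in X$, $0<r<w(x)$, and satisfy $$D^\ast f(x)\le\frac{K}{r}\sup_{y\in B_X(x,r)}d_Y(f(x),f(y)),\quad x\in X,\ 0<r<w(x).$$ For a weight $v$ on $X$, $\mathrm{B}_v(X,Y)$ is the class of $f\in D^\ast(X,Y)$ for which there is a constant $C_f$ with $D^\ast f(z)\le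 C_f v(z)$ for all $z\in X$; the least such constant is $\|f\|_{\mathrm{B}_v(X,Y)}$. For a non-negative function $\varphi$ on $[0,\infty)$, $\Lambda_\varphi(X,Y)$ is the class of $f:X\to Y$ for which there is a constant $C_f$ with $d_Y(f(x),f(y))\le C_f\varphi(d_X(x,y))$ for all $x,y\in X$; the infimum of all such $C_f$ is $\|f\|_{\Lambda_\varphi(X,Y)}$. *)

(* Defs.v *)
From HB Require Import structures.
From mathcomp Require Import all_boot all_order all_algebra.
From mathcomp Require Import all_classical all_reals all_analysis.

Set Implicit Arguments.
Unset Strict Implicit.
Unset Printing Implicit Defensive.

Import Order.TTheory GRing.Theory Num.Theory.
Import numFieldNormedType.Exports.

Local Open Scope classical_set_scope.
Local Open Scope ring_scope.

Section regularly_oscillating.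
Context {R : realType}.

Definition weight {X : metricType R} (w : X -> R) : Prop :=
  continuous w /\ (forall x, 0 < w x).

(* Only the values of [phi] on the open half-line, where the derivative is
   two-sided, are involved. *)
Definition C1_pos (phi : R -> R) : Prop :=
  forall t : R, 0 < t -> derivable phi t 1 /\ {for t, continuous (derive1 phi)}.

Context {X Y : metricType R}.
Implicit Types (f : X -> Y) (w v : X -> R) (phi : R -> R).

(* The limsup is over the punctured neighbourhoods of [x]. At an isolated
   point that filter is improper and [limf_esup] is -oo, hence the case
   distinction. *)
Definition Dstar f (x : X) : \bar R :=
  if `[< isolated [set: X] x >] then 0%E
  else limf_esup (fun y => (mdist (f x) (f y) / mdist x y)%:E) x^'.

Definition Dstar_class : set (X -> Y) :=
  [set f | forall x, (Dstar f x < +oo)%E].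

Definition bounded_on f (A : set X) : Prop :=
  exists M : R, forall y z, A y -> A z -> mdist (f y) (f z) <= M.

Definition RO (K : R) w : set (X -> Y) :=
  [set f | [/\ Dstar_class f,
    forall x r, 0 < r < w x -> bounded_on f (ball x r) &
    forall x r, 0 < r < w x ->
      (Dstar f x <= (K / r)%:E *
        ereal_sup [set (mdist (f x) (f y))%:E | y in ball x r])%E]].

(* In the two sets of constants below, [0 <= C] only matters in degenerate
   cases (e.g. X empty), where it keeps the seminorms well defined. *)
Definition B_const v f : set R :=
  [set C | 0 <= C /\ forall z, (Dstar f z <= (C * v z)%:E)%E].

Definition B_class v : set (X -> Y) :=
  [set f | Dstar_class f /\ B_const v f !=set0].

(* The infimum is attained, since the defining inequalities are closed in C. *)
Definition B_norm v f : R := inf (B_const v f).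

Definition Lambda_const phi f : set R :=
  [set C | 0 <= C /\ forall x y, mdist (f x) (f y) <= C * phi (mdist x y)].

Definition Lambda_class phi : set (X -> Y) :=
  [set f | Lambda_const phi f !=set0].

Definition Lambda_norm phi f : R := inf (Lambda_const phi f).

End regularly_oscillating.

(* Main.v *)
Require Import Defs.
From HB Require Import structures.
From mathcomp Require Import all_boot all_order all_algebra.
From mathcomp Require Import all_classical all_reals all_analysis.
From mathcomp Require Import ring.

(** The growth condition phi t / t < A phi' t makes phi' positive, because phi
    is non-negative; hence phi is nondecreasing on the open half-line and
    phi' \o w is a weight. If C is a Lambda_phi-constant of f, monotonicity
    bounds the oscillation of f on ball x r by C phi r, so the regular
    oscillation inequality gives, for 0 < r < w x,
      Dstar f x <= (K / r) C phi r <= A K C phi' r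
    (lemma [Dstar_le_derive1]). Since phi' is continuous at w x, letting r tend
    to w x from the left replaces phi' r by phi' (w x): every Lambda_phi-constant
    C of f yields the B-constant A K C (lemma [B_const_of_Lambda_const]), and
    the comparison of the seminorms follows by passing to infima. *)

Set Implicit Arguments.
Unset Strict Implicit.
Unset Printing Implicit Defensive.

Import Order.TTheory GRing.Theory Num.Theory.
Import numFieldNormedType.Exports.

Local Open Scope classical_set_scope.
Local Open Scope ring_scope.

Section growth.
Context {R : realType}.
Variables (phi : R -> R) (A : R).
Hypothesis phi_C1 : C1_pos phi.
Hypothesis phi_ge0 : forall t : R, 0 <= t -> 0 <= phi t.
Hypothesis A_gt0 : 0 < A.
Hypothesis phi_A : forall t : R, 0 < t -> phi t / t < A * derive1 phi t.

Lemma derive1_growth_gt0 t : 0 < t -> 0 < derive1 phi t.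
Proof.
move=> t0; rewrite -(pmulr_rgt0 _ A_gt0).
by apply: le_lt_trans (phi_A t0); rewrite divr_ge0 ?phi_ge0 // ltW.
Qed.

(** The bounds are positive because phi need not be continuous at 0, and
    phi 0 may exceed nearby values. *)
Lemma growth_nondecreasing s t : 0 < s -> s <= t -> phi s <= phi t.
Proof.
move=> s0 st.
have pos u : u \in `[s, t] -> 0 < u.
  by rewrite in_itv /= => /andP[su _]; exact: lt_le_trans su.
apply: (@ger0_derive1_ndecr _ phi s t) => // [u /subset_itv_oo_cc/pos u0|
    u /subset_itv_oo_cc/pos u0|].
- by case: (phi_C1 u0).
- exact/ltW/derive1_growth_gt0.
- by apply: derivable_within_continuous => u /pos u0; case: (phi_C1 u0).
Qed.

Lemma weight_derive1_comp (X : metricType R) (w : X -> R) :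
  weight w -> weight (derive1 phi \o w).
Proof.
move=> [cw w_gt0]; split=> x; last exact: derive1_growth_gt0.
apply: continuous_comp; first exact: cw.
by case: (phi_C1 (w_gt0 x)).
Qed.

Context {X Y : metricType R}.
Implicit Types (f : X -> Y) (w : X -> R).

Lemma Lambda_oscillation_le f C x r : Lambda_const phi f C -> 0 < r ->
  (ereal_sup [set (mdist (f x) (f y))%:E | y in ball x r] <= (C * phi r)%:E)%E.
Proof.
move=> [C0 fC] r0; apply: ge_ereal_sup => _ [y xry <-]; rewrite lee_fin.
move: xry; rewrite ballEmdist /= => xyr.
(* phi 0 is not comparable with phi r, so coinciding points are treated apart. *)
have [<-|xy] := eqVneq x y; first by rewrite mdistxx mulr_ge0 ?phi_ge0 // ltW.
apply: le_trans (fC x y) _; apply: ler_wpM2l => //.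
by apply: growth_nondecreasing; rewrite ?mdist_gt0 // ltW.
Qed.

Lemma Dstar_le_derive1 f K w C x r : 0 < K -> RO K w f ->
  Lambda_const phi f C -> 0 < r < w x ->
  (Dstar f x <= (A * K * C * derive1 phi r)%:E)%E.
Proof.
move=> K0 [_ _ fRO] fC r0w; have /andP[r0 _] := r0w.
apply: le_trans (fRO x r r0w) _.
have Kr0 : 0 <= K / r by rewrite divr_ge0 // ltW.
apply: le_trans (lee_wpmul2l _ (Lambda_oscillation_le x fC r0)) _.
  by rewrite lee_fin.
rewrite -EFinM lee_fin.
have -> : K / r * (C * phi r) = K * C * (phi r / r) by ring.
have -> : A * K * C * derive1 phi r = K * C * (A * derive1 phi r) by ring.
by rewrite ler_wpM2l ?(ltW (phi_A r0)) // mulr_ge0 ?(ltW K0) //; case: fC.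
Qed.

Lemma B_const_of_Lambda_const f K w C : 0 < K -> weight w -> RO K w f ->
  Lambda_const phi f C -> B_const (derive1 phi \o w) f (A * K * C).
Proof.
move=> K0 [_ w_gt0] fRO fC; split=> [|x /=].
  by rewrite !mulr_ge0 ?(ltW A_gt0) ?(ltW K0) //; case: fC.
have wx0 := w_gt0 x.
have cvg : (A * K * C * derive1 phi r)%:E @[r --> (w x)^'-]
    --> (A * K * C * derive1 phi (w x))%:E.
  apply: cvg_EFin; first exact: nearW.
  apply: cvgM; first exact: cvg_cst.
  apply: cvg_at_left_filter.
  by case: (phi_C1 wx0).
apply: (cvge_to_ge cvg).
near=> r; apply: (Dstar_le_derive1 K0 fRO fC).
apply/andP; split; near: r; [exact: nbhs_left_gt | exact: nbhs_left_lt].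
Unshelve. all: by end_near. Qed.

End growth.

Theorem theorem3p3 (R : realType) (X Y : metricType R) (phi : R -> R) (A : R)
    (phi_C1 : C1_pos phi)
    (phi_ge0 : forall t : R, 0 <= t -> 0 <= phi t)
    (A_gt0 : 0 < A)
    (phi_A : forall t : R, 0 < t -> phi t / t < A * derive1 phi t) :
  forall (K : R) (w : X -> R), 0 < K -> weight w ->
    weight (derive1 phi \o w) /\
    forall f : X -> Y, (Lambda_class phi `&` RO K w) f ->
      B_class (derive1 phi \o w) f /\
      B_norm (derive1 phi \o w) f <= A * K * Lambda_norm phi f.
Proof.
move=> K w K0 hw; split; first exact: (weight_derive1_comp phi_C1 phi_ge0 A_gt0).
move=> f [[C0 fC0] fRO].
have BC C : Lambda_const phi f C -> B_const (derive1 phi \o w) f (A * K * C).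
  exact: (B_const_of_Lambda_const phi_C1 phi_ge0 A_gt0 phi_A K0 hw fRO).
split; first by split; [case: fRO | exists (A * K * C0); exact: BC].
have AK0 : 0 < A * K by rewrite mulr_gt0.
rewrite -ler_pdivrMl //; apply: lb_le_inf => [|C fC]; first by exists C0.
rewrite ler_pdivrMl //; apply: ge_inf; last exact: BC.
by exists 0 => c [].
Qed.
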